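(* For $\sigma>0$ let $F(a,b)=\operatorname{sgn}(\sigma)\,H^{\sigma}=(a+b)^{\sigma}$ for $a,b>0$, where $H=a+b$. If $\sigma\ge 7$, then there exists no maximum-principle function (MPF) for the normal velocity $F$. In fact, the same non-existence already holds for all $\sigma\ge 5.98$.
   Context: Notation: $\mathbb{R}^2_+=(0,\infty)^2$; subscripts $a,b$ denote partial derivatives. Normal velocity: a symmetric function $F\in C^2(\mathbb{R}^2_+)$, homogeneous of some degree $\sigma\in\mathbb{R}\setminus\{0\}$, with $F_a,F_b>0$ for all $a,b>0$. It is contracting if $F>0$ everywhere on $\mathbb{R}^2_+$ and expanding if $F<0$ everywhere on $\mathbb{R}^2_+$. Maximum-principle function (MPF) for a normal velocity $F$: a symmetric function $w\in C^2(\mathbb{R}^2_+)$, homogeneous of some degree $\chi\in\mathbb{R}\setminus\{0\}$, such that, with $\alpha=-w_a/w_b$ and $\alpha_a=\partial\alpha/\partial a$ (defined for $a\ne b$): (1) $w>0$ whenever $a\neq b$, and $w=0$ whenever $a=b$. (2) $\chi>0$ if $F$ is contracting, $\chi<0$ if $F$ is expanding. (3) $w_a<0$ for all $0<a<b$, and $w_a>0$ for all $0<b<a$. (4) For all $a,b>0$ (for $E_w,G_w$: $a\neq b$) one has $C_w(a,b)\le0$, $E_w(a,b)\le0$, $G_w(a,b)\le 0$, where $$C_w=w_a\,a\big((F_aa^2+F_bb^2)+(F-F_aa-F_bb)a\big)+w_b\,b\big((F_aa^2+F_bb^2)+(F-F_aa-F_bb)b\big),$$ $$E_w=w_a(F_{aa}+2F_{ab}\alpha+F_{bb}\alpha^2)-F_a(w_{aa}+2w_{ab}\alpha+w_{bb}\alpha^2)+2\,\frac{w_bF_a-w_aF_b}{a-b}\,\alpha^2,$$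 $$G_w=\frac1{\alpha^2}\Big(w_b(F_{aa}+2F_{ab}\alpha+F_{bb}\alpha^2)-F_b(w_{aa}+2w_{ab}\alpha+w_{bb}\alpha^2)+2\,\frac{w_bF_a-w_aF_b}{a-b}\Big).$$ (5) There are constants $c>0$, $d\in\mathbb{R}$ such that, evaluating $\alpha$ and $\alpha_a$ at $(a,b)=(\rho,1)$ with $0<\rho<1$: if $F$ is contracting, then either $\alpha=c$ and $\alpha_a=0$ for all sufficiently small $\rho$, or, as $\rho\to0$, $\alpha=\frac c\rho+o(\rho^{-1})$ and $\alpha_a=-\frac c{\rho^2}+o(\rho^{-1})$; if $F$ is expanding, then, as $\rho\to0$, either $\alpha=\frac c\rho+o(\rho^{-1})$ and $\alpha_a=-\frac c{\rho^2}+o(\rho^{-1})$, or $\alpha=\frac{c+d\rho}{\rho^2}+o(\rho^{-1})$ and $\alpha_a=-\frac{2c+d\rho}{\rho^3}+o(\rho^{-1})$. *)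

(* Defs.v *)
From Stdlib Require Import Reals Lra.
From Coquelicot Require Import Coquelicot.
Open Scope R_scope.

(* Functions on the open quadrant (0,oo)^2 are total functions R -> R -> R of
   which only the values at positive arguments are ever constrained or used. *)

Definition Da (f : R -> R -> R) (a b : R) : R := Derive (fun x => f x b) a.
Definition Db (f : R -> R -> R) (a b : R) : R := Derive (fun y => f a y) b.

(* [ex_diff_n f 2 a b]: the partial derivatives of [f] of order <= 2 exist at
   (a,b) and are continuous there, jointly in both variables. *)
Definition C2_quadrant (f : R -> R -> R) : Prop :=
  forall a b, 0 < a -> 0 < b -> ex_diff_n f 2 a b.

Definition symmetric_quadrant (f : R -> R -> R) : Prop :=
  forall a b, 0 < a -> 0 < b -> f a b = f b a.

Definition homogeneous_quadrant (f : R -> R -> R) (deg : R) : Prop :=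
  forall t a b, 0 < t -> 0 < a -> 0 < b ->
    f (t * a) (t * b) = Rpower t deg * f a b.

Record normal_velocity : Type := NormalVelocity {
  nv_fun :> R -> R -> R;
  nv_sym : symmetric_quadrant nv_fun;
  nv_C2 : C2_quadrant nv_fun;
  nv_homog : exists deg, deg <> 0 /\ homogeneous_quadrant nv_fun deg;
  nv_Da_pos : forall a b, 0 < a -> 0 < b -> 0 < Da nv_fun a b;
  nv_Db_pos : forall a b, 0 < a -> 0 < b -> 0 < Db nv_fun a b
}.

Definition contracting (F : normal_velocity) : Prop :=
  forall a b, 0 < a -> 0 < b -> 0 < F a b.
Definition expanding (F : normal_velocity) : Prop :=
  forall a b, 0 < a -> 0 < b -> F a b < 0.

Definition alpha (w : R -> R -> R) (a b : R) : R := - Da w a b / Db w a b.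

Definition C_term (F w : R -> R -> R) (a b : R) : R :=
  let Fa := Da F a b in let Fb := Db F a b in
  Da w a b * a * ((Fa * a ^ 2 + Fb * b ^ 2) + (F a b - Fa * a - Fb * b) * a)
  + Db w a b * b * ((Fa * a ^ 2 + Fb * b ^ 2) + (F a b - Fa * a - Fb * b) * b).

(* f_aa + 2 f_ab al + f_bb al^2 *)
Definition hess_form (f : R -> R -> R) (al a b : R) : R :=
  Da (Da f) a b + 2 * Db (Da f) a b * al + Db (Db f) a b * al ^ 2.

Definition E_term (F w : R -> R -> R) (a b : R) : R :=
  let al := alpha w a b in
  Da w a b * hess_form F al a b - Da F a b * hess_form w al a b
  + 2 * ((Db w a b * Da F a b - Da w a b * Db F a b) / (a - b)) * al ^ 2.

Definition G_term (F w : R -> R -> R) (a b : R) : R :=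
  let al := alpha w a b in
  1 / al ^ 2 *
  (Db w a b * hess_form F al a b - Db F a b * hess_form w al a b
   + 2 * ((Db w a b * Da F a b - Da w a b * Db F a b) / (a - b))).

(* phi(rho) = psi(rho) + o(1/rho) as rho decreases to 0 *)
Definition eq_up_to_o_inv (phi psi : R -> R) : Prop :=
  is_domin (at_right 0) (fun rho : R => / rho)
    (fun rho : R => phi rho - psi rho).

Definition alpha_constant_near_0 (w : R -> R -> R) (c : R) : Prop :=
  at_right 0 (fun rho => alpha w rho 1 = c /\ Da (alpha w) rho 1 = 0).

Definition alpha_first_order (w : R -> R -> R) (c : R) : Prop :=
  eq_up_to_o_inv (fun rho => alpha w rho 1) (fun rho => c / rho) /\
  eq_up_to_o_inv (fun rho => Da (alpha w) rho 1) (fun rho => - c / rho ^ 2).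

Definition alpha_second_order (w : R -> R -> R) (c d : R) : Prop :=
  eq_up_to_o_inv (fun rho => alpha w rho 1)
    (fun rho => (c + d * rho) / rho ^ 2) /\
  eq_up_to_o_inv (fun rho => Da (alpha w) rho 1)
    (fun rho => - (2 * c + d * rho) / rho ^ 3).

Record MPF_of_degree (F : normal_velocity) (chi : R) (w : R -> R -> R) : Prop := {
  mpf_sym : symmetric_quadrant w;
  mpf_C2 : C2_quadrant w;
  mpf_homog : homogeneous_quadrant w chi;
  mpf_pos : forall a b, 0 < a -> 0 < b -> a <> b -> 0 < w a b;
  mpf_diag : forall a b, 0 < a -> 0 < b -> a = b -> w a b = 0;
  mpf_deg_contracting : contracting F -> 0 < chi;
  mpf_deg_expanding : expanding F -> chi < 0;
  mpf_Da_neg : forall a b, 0 < a -> a < b -> Da w a b < 0;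
  mpf_Da_pos : forall a b, 0 < b -> b < a -> 0 < Da w a b;
  mpf_C : forall a b, 0 < a -> 0 < b -> C_term F w a b <= 0;
  mpf_E : forall a b, 0 < a -> 0 < b -> a <> b -> E_term F w a b <= 0;
  mpf_G : forall a b, 0 < a -> 0 < b -> a <> b -> G_term F w a b <= 0;
  mpf_asymptotics : exists c d : R, 0 < c /\
    (contracting F -> alpha_constant_near_0 w c \/ alpha_first_order w c) /\
    (expanding F -> alpha_first_order w c \/ alpha_second_order w c d)
}.

Definition MPF (F : normal_velocity) (w : R -> R -> R) : Prop :=
  exists chi : R, chi <> 0 /\ MPF_of_degree F chi w.

Definition H_power (sigma a b : R) : R := sign sigma * Rpower (a + b) sigma.

Lemma H_power_pos (sigma a b : R) :
  0 < sigma -> H_power sigma a b = Rpower (a + b) sigma.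
Proof. intros hs; unfold H_power; rewrite sign_eq_1 by exact hs; ring. Qed.

Lemma is_derive_Rpower_sum_l (k s a b : R) : 0 < a -> 0 < b ->
  is_derive (fun x => k * Rpower (x + b) s) a (k * s * Rpower (a + b) (s - 1)).
Proof.
intros ha hb; rewrite Rmult_assoc.
apply (is_derive_scal (fun x => Rpower (x + b) s)).
rewrite <- (Rmult_1_l (s * _)).
apply (is_derive_comp (fun u => Rpower u s) (fun x => x + b)).
- apply is_derive_Reals, derivable_pt_lim_power; lra.
- auto_derive; [exact I | ring].
Qed.

Lemma is_derive_Rpower_sum_r (k s a b : R) : 0 < a -> 0 < b ->
  is_derive (fun y => k * Rpower (a + y) s) b (k * s * Rpower (a + b) (s - 1)).
Proof.
intros ha hb; rewrite (Rplus_comm a b).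
apply (is_derive_ext (fun y => k * Rpower (y + a) s)).
- intros t; now rewrite (Rplus_comm t a).
- now apply is_derive_Rpower_sum_l.
Qed.

Lemma locally_2d_quadrant (P : R -> R -> Prop) (a b : R) : 0 < a -> 0 < b ->
  (forall u v, 0 < u -> 0 < v -> P u v) -> locally_2d P a b.
Proof.
intros ha hb HP.
exists (mkposreal (Rmin a b) (Rmin_pos a b ha hb)); simpl; intros u v hu hv.
pose proof (Rmin_l a b); pose proof (Rmin_r a b).
apply Rabs_def2 in hu; apply Rabs_def2 in hv; apply HP; lra.
Qed.

Lemma ex_diff_n_Rpower_sum (n : nat) (k s a b : R) : 0 < a -> 0 < b ->
  ex_diff_n (fun x y => k * Rpower (x + y) s) n a b.
Proof.
revert k s a b; induction n as [|n IH]; intros k s a b ha hb;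
  (split; [apply (continuity_1d_2d_pt_comp (fun u => k * Rpower u s));
    [apply derivable_continuous_pt; exists (k * (s * Rpower (a + b) (s - 1)));
     apply derivable_pt_lim_scal, derivable_pt_lim_power; lra
    | apply continuity_2d_pt_plus;
      [apply continuity_2d_pt_id1 | apply continuity_2d_pt_id2]] |]).
- exact I.
- split; [|split; [|split]].
  + eexists; now apply is_derive_Rpower_sum_l.
  + eexists; now apply is_derive_Rpower_sum_r.
  + apply (ex_diff_n_ext_loc (fun u v => k * s * Rpower (u + v) (s - 1)));
      [|now apply IH].
    apply locally_2d_quadrant; auto; intros u v hu hv; symmetry.
    now apply is_derive_unique, is_derive_Rpower_sum_l.
  + apply (ex_diff_n_ext_loc (fun u v => k * s * Rpower (u + v) (s - 1)));
      [|now apply IH].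
    apply locally_2d_quadrant; auto; intros u v hu hv; symmetry.
    now apply is_derive_unique, is_derive_Rpower_sum_r.
Qed.

Lemma H_power_sym (sigma : R) : symmetric_quadrant (H_power sigma).
Proof. intros a b _ _; unfold H_power; now rewrite (Rplus_comm a b). Qed.

Lemma H_power_C2 (sigma : R) : C2_quadrant (H_power sigma).
Proof. intros a b; apply ex_diff_n_Rpower_sum. Qed.

Lemma H_power_homog (sigma : R) : 0 < sigma ->
  exists deg, deg <> 0 /\ homogeneous_quadrant (H_power sigma) deg.
Proof.
intros hsigma; exists sigma; split; [lra|]; intros t a b ht ha hb; unfold H_power.
rewrite <- Rmult_plus_distr_l, <- Rpower_mult_distr by lra; ring.
Qed.

Lemma H_power_Da_pos (sigma : R) (hsigma : 0 < sigma) (a b : R) :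
  0 < a -> 0 < b -> 0 < Da (H_power sigma) a b.
Proof.
intros ha hb; unfold Da, H_power.
rewrite (is_derive_unique _ _ _ (is_derive_Rpower_sum_l _ _ _ _ ha hb)).
rewrite sign_eq_1 by exact hsigma.
apply Rmult_lt_0_compat; [lra | apply exp_pos].
Qed.

Lemma H_power_Db_pos (sigma : R) (hsigma : 0 < sigma) (a b : R) :
  0 < a -> 0 < b -> 0 < Db (H_power sigma) a b.
Proof.
intros ha hb; unfold Db, H_power.
rewrite (is_derive_unique _ _ _ (is_derive_Rpower_sum_r _ _ _ _ ha hb)).
rewrite sign_eq_1 by exact hsigma.
apply Rmult_lt_0_compat; [lra | apply exp_pos].
Qed.

Definition H_velocity (sigma : R) (hsigma : 0 < sigma) : normal_velocity :=
  NormalVelocity (H_power sigma) (H_power_sym sigma) (H_power_C2 sigma)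
    (H_power_homog sigma hsigma) (H_power_Da_pos sigma hsigma)
    (H_power_Db_pos sigma hsigma).

Lemma H_velocity_contracting (sigma : R) (hsigma : 0 < sigma) :
  contracting (H_velocity sigma hsigma).
Proof.
intros a b ha hb; simpl; rewrite H_power_pos by exact hsigma; apply exp_pos.
Qed.

(* Main.v *)
Require Import Defs.
From Stdlib Require Import Reals.
From Stdlib Require Import Lra.
From Coquelicot Require Import Coquelicot.
Open Scope R_scope.

(** Restrict to (a, b) = (r, 1) with 0 < r < 1.  By Euler's relation
    y = (1 - r alpha) / (1 + alpha) equals chi g / (chi g - (1 + r) g') with
    g(r) = w(r, 1), so that 0 < y < 1, and with k = sigma - 1 the inequality
    G_w <= 0 becomes
      (1 - r^2) y y' >= (1 - r) (k (y + r) - y (1 - y)) - 2 (y + r)^2.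
    For k >= 4.98 the function Y(r) = r (24/5 - 23/4 r) satisfies the opposite
    strict inequality on (0, 2/5].  Hence Y - y decreases wherever it is
    positive; since Y(0) = 0 < y, it is never positive, and
    y(2/5) >= Y(2/5) = 1 contradicts y < 1. *)

(** * Homogeneous functions along b = 1 *)

Lemma homogeneous_from_unit_l (f : R -> R -> R) (deg a b : R) :
  homogeneous_quadrant f deg -> 0 < a -> 0 < b ->
  f a b = Rpower b deg * f (a / b) 1.
Proof.
intros hf ha hb.
rewrite <- hf by (try apply Rdiv_lt_0_compat; lra).
f_equal; field; lra.
Qed.

Lemma locally_pos (a : R) : 0 < a -> locally a (fun x => 0 < x).
Proof. intros ha; exact (open_gt 0 a ha). Qed.

Lemma homogeneous_Da (f : R -> R -> R) (deg : R) :
  homogeneous_quadrant f deg ->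
  (forall a b, 0 < a -> 0 < b -> ex_derive (fun x => f x b) a) ->
  homogeneous_quadrant (Da f) (deg - 1).
Proof.
intros hf df t a b ht ha hb; unfold Da.
assert (hta : 0 < t * a) by (apply Rmult_lt_0_compat; lra).
apply is_derive_unique.
apply (is_derive_ext_loc (fun x => Rpower t deg * f (x / t) b)).
- apply (filter_imp (fun x => 0 < x)); [|now apply locally_pos].
  intros x hx; rewrite <- hf by (try apply Rdiv_lt_0_compat; lra).
  f_equal; field; lra.
- assert (e : Rpower t (deg - 1) = Rpower t deg / t).
  { unfold Rminus; rewrite Rpower_plus, Rpower_Ropp, Rpower_1 by lra; reflexivity. }
  assert (ea : t * a * / t = a) by (field; lra).
  auto_derive.
  + unfold Rdiv; rewrite ea; now apply df.
  + rewrite e; unfold Rdiv; rewrite ea; field; lra.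
Qed.

Lemma homogeneous_Db (f : R -> R -> R) (deg : R) :
  homogeneous_quadrant f deg ->
  (forall a b, 0 < a -> 0 < b -> ex_derive (fun y => f a y) b) ->
  homogeneous_quadrant (Db f) (deg - 1).
Proof.
intros hf df t a b ht ha hb.
apply (homogeneous_Da (fun u v => f v u) deg); auto.
intros s u v hs hu hv; now apply hf.
Qed.

(** Writing [f a y] as y^deg f(a / y, 1) turns the derivative in y into one of the profile on the
    line b = 1; at y = 1 this is Euler's relation. *)
Lemma Euler_unit (f : R -> R -> R) (deg a : R) :
  homogeneous_quadrant f deg -> 0 < a -> ex_derive (fun x => f x 1) a ->
  Db f a 1 = deg * f a 1 - a * Da f a 1.
Proof.
intros hf ha df; unfold Db, Da.
apply is_derive_unique.
apply (is_derive_ext_loc (fun y => exp (deg * ln y) * f (a / y) 1)).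
- apply (filter_imp (fun x => 0 < x)); [|apply locally_pos; lra].
  intros y hy; symmetry; now apply homogeneous_from_unit_l.
- assert (ea : a * / 1 = a) by field.
  auto_derive.
  + unfold Rdiv; rewrite ea; repeat split; try assumption; lra.
  + unfold Rdiv; rewrite ea, ln_1, Rmult_0_r, exp_0; field.
Qed.

(** * The differential inequality for y *)

(* Here g = w(x, 1), p = w_a, s = w_aa and q = w_b, so that [dy] is the
   derivative of [y] in x; the hypothesis is G_w <= 0 without its positive factor. *)
Lemma G_to_y (x chi g p s k : R) :
  0 < x < 1 -> 0 < chi -> 0 < g -> p < 0 ->
  let q := chi * g - x * p in
  let wab := (chi - 1) * p - x * s in
  let wbb := (chi - 1) * q - x * wab in
  let al := - p / q in
  let N := chi * g - (1 + x) * p in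
  let y := chi * g / N in
  let dy := chi * (g * p + (1 + x) * (g * s - p ^ 2)) / N ^ 2 in
  q * k * (1 + al) ^ 2 - (1 + x) * (s + 2 * wab * al + wbb * al ^ 2)
    + 2 * (1 + x) * ((q - p) / (x - 1)) <= 0 ->
  (1 - x) * (k * (y + x) - y * (1 - y)) - 2 * (y + x) ^ 2
    <= (1 - x) * (1 + x) * y * dy.
Proof.
intros hx hchi hg hp q wab wbb al N y dy hG.
assert (hcg : 0 < chi * g) by now apply Rmult_lt_0_compat.
assert (hq : 0 < q) by (unfold q; nra).
assert (hN : 0 < N) by (unfold N; nra).
apply Rminus_le.
(* The factor comes from [N = q - p], hence 1 + al = N / q and y + x = (1 + x) q / N. *)
match goal with |- ?l <= 0 =>
  replace l with ((1 - x) * (1 + x) * q ^ 2 / N ^ 3 *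
   (q * k * (1 + al) ^ 2 - (1 + x) * (s + 2 * wab * al + wbb * al ^ 2)
    + 2 * (1 + x) * ((q - p) / (x - 1)))) end.
- assert (0 < (1 - x) * (1 + x) * q ^ 2 / N ^ 3).
  { apply Rdiv_lt_0_compat; [|now apply pow_lt].
    repeat apply Rmult_lt_0_compat; try lra. }
  nra.
- unfold y, dy, al, wbb, wab, N in *; unfold q in *; field; lra.
Qed.

(** * Comparison of y with the quadratic Y *)

Lemma subsolution (k r : R) : 498 / 100 <= k -> 0 < r <= 2 / 5 ->
  let Y := r * (24 / 5 - 23 / 4 * r) in
  (1 - r) * (1 + r) * Y * (24 / 5 - 23 / 2 * r)
  < (1 - r) * (k * (Y + r) - Y * (1 - Y)) - 2 * (Y + r) ^ 2.
Proof.
intros hk hr Y.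
assert (hY : 0 < Y) by (unfold Y; nra).
(* The coefficient (1 - r) (Y + r) of k is positive, so k = 498/100 is the worst case. There the
   right side minus the left side is exactly the polynomial in [hQ]. *)
assert (h : (1 - r) * (498 / 100 * (Y + r)) <= (1 - r) * (k * (Y + r))).
{ apply Rmult_le_compat_l; [lra|]; apply Rmult_le_compat_r; lra. }
(* The quartic in [hQ] is a combination of [h1], [h2], [r ^ 2] with nonnegative
   weights, plus an affine function that is positive on [0, 2/5]. *)
assert (h1 : 0 <= r ^ 2 * (r - 1 / 5) ^ 2)
  by (apply Rmult_le_pos; apply pow2_ge_0).
assert (h2 : 0 <= (2 / 5 - r) * (r - 77 / 500) ^ 2)
  by (apply Rmult_le_pos; [lra | apply pow2_ge_0]).
assert (hQ : 0 < r * (261 / 250 - 8409 / 1000 * r + 874 / 25 * r ^ 2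
               - 4853 / 80 * r ^ 3 + 529 / 16 * r ^ 4)).
{ pose proof (pow2_ge_0 r).
  apply Rmult_lt_0_compat; lra. }
unfold Y in *; clear hY h1 h2; lra.
Qed.

(* Dividing [R y := (1 - r) (k (y + r) - y (1 - y)) - 2 (y + r)^2] by y gives a
   decreasing function of y > 0. *)
Lemma slope_comparison (k r y Y dy dY : R) :
  498 / 100 <= k -> 0 < r <= 2 / 5 -> 0 < y -> y < Y ->
  (1 - r) * (k * (y + r) - y * (1 - y)) - 2 * (y + r) ^ 2
    <= (1 - r) * (1 + r) * y * dy ->
  (1 - r) * (1 + r) * Y * dY
    < (1 - r) * (k * (Y + r) - Y * (1 - Y)) - 2 * (Y + r) ^ 2 ->
  dY < dy.
Proof.
intros hk hr hy hyY h1 h2.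
destruct (Rlt_or_le dY dy) as [h | h]; [exact h | exfalso].
assert (hr1 : 0 < (1 - r) * (1 + r)) by nra.
assert (h3 : (1 - r) * (1 + r) * y * dy <= (1 - r) * (1 + r) * y * dY).
{ apply Rmult_le_compat_l; [apply Rmult_le_pos; lra | exact h]. }
assert (h4 : Y * ((1 - r) * (k * (y + r) - y * (1 - y)) - 2 * (y + r) ^ 2)
   < y * ((1 - r) * (k * (Y + r) - Y * (1 - Y)) - 2 * (Y + r) ^ 2)).
{ apply Rle_lt_trans with (Y * ((1 - r) * (1 + r) * y * dY)).
  - apply Rmult_le_compat_l; lra.
  - replace (Y * ((1 - r) * (1 + r) * y * dY))
      with (y * ((1 - r) * (1 + r) * Y * dY)) by ring.
    apply Rmult_lt_compat_l; assumption. }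
(* This product is exactly Y R(y) - y R(Y), which [h4] makes negative. *)
assert (h5 : 0 < (Y - y) * (r * ((1 - r) * k - 2 * r) + y * Y * (1 + r))).
{ apply Rmult_lt_0_compat; [lra|].
  assert (0 < y * Y * (1 + r)).
  { repeat apply Rmult_lt_0_compat; lra. }
  assert (0 <= r * ((1 - r) * k - 2 * r)) by (apply Rmult_le_pos; nra).
  lra. }
nra.
Qed.

Lemma fun_decr_left (D : R -> R) (m l a : R) :
  is_derive D m l -> l < 0 -> a < m -> exists x, a < x < m /\ D m < D x.
Proof.
intros hD hl ham.
apply is_derive_Reals in hD.
(* With tolerance - l the difference quotients stay below l + (- l) = 0. *)
destruct (hD (- l)) as [d hd]; [lra|].
pose proof (cond_pos d) as hdp.
set (h := - Rmin (d / 2) ((m - a) / 2)).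
assert (hm : 0 < Rmin (d / 2) ((m - a) / 2)) by (apply Rmin_pos; lra).
pose proof (Rmin_l (d / 2) ((m - a) / 2)).
pose proof (Rmin_r (d / 2) ((m - a) / 2)).
exists (m + h); split; [unfold h; lra|].
assert (hh : h < 0) by (unfold h; lra).
specialize (hd h ltac:(lra)).
assert (hab : Rabs h < d) by (rewrite Rabs_left by lra; unfold h; lra).
apply hd, Rabs_def2 in hab; destruct hab as [hab _].
assert (hq : (D (m + h) - D m) / h < 0) by lra.
assert (0 < D (m + h) - D m).
{ replace (D (m + h) - D m) with ((- h) * - ((D (m + h) - D m) / h)) by (field; lra).
  apply Rmult_lt_0_compat; lra. }
lra.
Qed.

(** If D b > 0, pick r1 with D r1 < D b and a maximum point m of D on [r1, b]. Then D m >= D b > 0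
    and m > r1, so D has negative derivative at m and is larger somewhere in (r1, m), a
    contradiction. No limit of D at 0 is required, only small values arbitrarily found. *)
Lemma positive_decr_nonpos (D dD : R -> R) (b : R) :
  0 < b ->
  (forall r, 0 < r <= b -> is_derive D r (dD r)) ->
  (forall r, 0 < r <= b -> 0 < D r -> dD r < 0) ->
  (forall eps, 0 < eps -> exists r, 0 < r < b /\ D r < eps) ->
  D b <= 0.
Proof.
intros hb hD hdecr hsmall.
destruct (Rle_or_lt (D b) 0) as [h | h]; [exact h | exfalso].
destruct (hsmall (D b) h) as [r1 [hr1 hDr1]].
destruct (continuity_ab_maj D r1 b) as [m [hmax hm]]; [lra | |].
{ intros c hc; apply derivable_continuous_pt; exists (dD c).
  apply is_derive_Reals, hD; lra. }
assert (hDm : D b <= D m) by (apply hmax; lra).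
assert (hm1 : r1 < m).
{ destruct (Req_dec r1 m) as [e | e]; [subst; lra | lra]. }
destruct (fun_decr_left D m (dD m) r1) as [x [hx hlt]]; auto.
- apply hD; lra.
- apply hdecr; lra.
- assert (D x <= D m) by (apply hmax; lra); lra.
Qed.

Lemma y_reaches_one (k : R) (y dy : R -> R) :
  498 / 100 <= k ->
  (forall r, 0 < r <= 2 / 5 -> 0 < y r) ->
  (forall r, 0 < r <= 2 / 5 -> is_derive y r (dy r)) ->
  (forall r, 0 < r <= 2 / 5 ->
    (1 - r) * (k * (y r + r) - y r * (1 - y r)) - 2 * (y r + r) ^ 2
      <= (1 - r) * (1 + r) * y r * dy r) ->
  1 <= y (2 / 5).
Proof.
intros hk hpos hder hineq.
enough (h : 2 / 5 * (24 / 5 - 23 / 4 * (2 / 5)) - y (2 / 5) <= 0) by lra.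
apply (positive_decr_nonpos (fun r => r * (24 / 5 - 23 / 4 * r) - y r)
  (fun r => (24 / 5 - 23 / 2 * r) - dy r)); [lra | | |].
- intros r hr; apply (is_derive_minus (fun r => r * (24 / 5 - 23 / 4 * r)) y).
  + auto_derive; [exact I | field].
  + now apply hder.
- intros r hr hlt.
  enough (24 / 5 - 23 / 2 * r < dy r) by lra.
  apply (slope_comparison k r (y r) (r * (24 / 5 - 23 / 4 * r))); auto.
  + lra.
  + now apply subsolution.
- intros eps heps.
  (* Y(r) < 5 r and y > 0, so r <= eps / 5 gives Y - y < eps; the bound 1/5 keeps r inside the
     interval. *)
  assert (hm : 0 < Rmin (1 / 5) (eps / 5)) by (apply Rmin_pos; lra).
  pose proof (Rmin_l (1 / 5) (eps / 5)); pose proof (Rmin_r (1 / 5) (eps / 5)).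
  exists (Rmin (1 / 5) (eps / 5)); split; [lra|].
  set (r := Rmin (1 / 5) (eps / 5)) in *.
  assert (0 < y r) by (apply hpos; lra).
  nra.
Qed.

(** * Evaluation of G_w at (x, 1) for powers of H *)

Lemma C2_quadrant_derivatives (f : R -> R -> R) (a b : R) :
  C2_quadrant f -> 0 < a -> 0 < b ->
  ex_derive (fun x => f x b) a /\ ex_derive (fun y => f a y) b /\
  ex_derive (fun x => Da f x b) a /\ ex_derive (fun y => Da f a y) b /\
  ex_derive (fun x => Db f x b) a /\ ex_derive (fun y => Db f a y) b.
Proof.
intros hf ha hb.
destruct (hf a b ha hb) as
  (_ & h1 & h2 & (_ & h3 & h4 & _) & (_ & h5 & h6 & _)).
repeat split; assumption.
Qed.

Lemma H_power_Da (sigma a b : R) : 0 < sigma -> 0 < a -> 0 < b ->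
  Da (H_power sigma) a b = sigma * Rpower (a + b) (sigma - 1).
Proof.
intros hs ha hb; unfold Da, H_power.
rewrite (is_derive_unique _ _ _ (is_derive_Rpower_sum_l _ _ _ _ ha hb)).
rewrite sign_eq_1 by exact hs; ring.
Qed.

Lemma H_power_Db (sigma a b : R) : 0 < sigma -> 0 < a -> 0 < b ->
  Db (H_power sigma) a b = sigma * Rpower (a + b) (sigma - 1).
Proof.
intros hs ha hb; unfold Db, H_power.
rewrite (is_derive_unique _ _ _ (is_derive_Rpower_sum_r _ _ _ _ ha hb)).
rewrite sign_eq_1 by exact hs; ring.
Qed.

(** As F depends on a + b only, its second partial derivatives all coincide and the form is a
    multiple of a perfect square. *)
Lemma H_power_hess_form (sigma al a b : R) : 0 < sigma -> 0 < a -> 0 < b ->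
  hess_form (H_power sigma) al a b
  = sigma * (sigma - 1) * Rpower (a + b) (sigma - 1 - 1) * (1 + al) ^ 2.
Proof.
intros hs ha hb; unfold hess_form.
assert (haa : Da (Da (H_power sigma)) a b
  = sigma * (sigma - 1) * Rpower (a + b) (sigma - 1 - 1)).
{ apply is_derive_unique.
  apply (is_derive_ext_loc (fun x => sigma * Rpower (x + b) (sigma - 1))).
  - apply (filter_imp (fun x => 0 < x)); [|now apply locally_pos].
    intros x hx; symmetry; now apply H_power_Da.
  - now apply is_derive_Rpower_sum_l. }
assert (hab : Db (Da (H_power sigma)) a b
  = sigma * (sigma - 1) * Rpower (a + b) (sigma - 1 - 1)).
{ apply is_derive_unique.
  apply (is_derive_ext_loc (fun y => sigma * Rpower (a + y) (sigma - 1))).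
  - apply (filter_imp (fun x => 0 < x)); [|now apply locally_pos].
    intros x hx; symmetry; now apply H_power_Da.
  - now apply is_derive_Rpower_sum_r. }
assert (hbb : Db (Db (H_power sigma)) a b
  = sigma * (sigma - 1) * Rpower (a + b) (sigma - 1 - 1)).
{ apply is_derive_unique.
  apply (is_derive_ext_loc (fun y => sigma * Rpower (a + y) (sigma - 1))).
  - apply (filter_imp (fun x => 0 < x)); [|now apply locally_pos].
    intros x hx; symmetry; now apply H_power_Db.
  - now apply is_derive_Rpower_sum_r. }
rewrite haa, hab, hbb; ring.
Qed.

(** Euler's relation for w, w_a and w_b leaves only w, w_a and w_aa on the line b = 1, as [G_to_y]
    expects. *)
Lemma hess_form_unit (w : R -> R -> R) (chi al x : R) :
  homogeneous_quadrant w chi -> C2_quadrant w -> 0 < x ->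
  let q := chi * w x 1 - x * Da w x 1 in
  let wab := (chi - 1) * Da w x 1 - x * Da (Da w) x 1 in
  let wbb := (chi - 1) * q - x * wab in
  Db w x 1 = q /\
  hess_form w al x 1 = Da (Da w) x 1 + 2 * wab * al + wbb * al ^ 2.
Proof.
intros hw dw hx q wab wbb.
assert (hq : forall z, 0 < z -> Db w z 1 = chi * w z 1 - z * Da w z 1).
{ intros z hz; apply Euler_unit; auto.
  exact (proj1 (C2_quadrant_derivatives w z 1 dw hz Rlt_0_1)). }
assert (hDa : homogeneous_quadrant (Da w) (chi - 1)).
{ apply homogeneous_Da; [exact hw|]; intros a b ha hb.
  exact (proj1 (C2_quadrant_derivatives w a b dw ha hb)). }
assert (hDb : homogeneous_quadrant (Db w) (chi - 1)).
{ apply homogeneous_Db; [exact hw|]; intros a b ha hb.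
  exact (proj1 (proj2 (C2_quadrant_derivatives w a b dw ha hb))). }
destruct (C2_quadrant_derivatives w x 1 dw hx Rlt_0_1)
  as (e1 & _ & e3 & _ & e5 & _).
assert (hab : Db (Da w) x 1 = wab) by (now apply Euler_unit).
(* Euler's relation for w_b involves this other mixed derivative; it is found by differentiating
   [hq] along the line b = 1. *)
assert (hba : Da (Db w) x 1 = wab).
{ apply is_derive_unique.
  apply (is_derive_ext_loc (fun z => chi * w z 1 - z * Da w z 1)).
  - apply (filter_imp (fun z => 0 < z)); [|now apply locally_pos].
    intros z hz; symmetry; now apply hq.
  - auto_derive; [now repeat split|].
    unfold wab; fold (Da w x 1) (Da (Da w) x 1); ring. }
split; [now apply hq|].
unfold hess_form; rewrite hab.
rewrite (Euler_unit (Db w) (chi - 1) x hDb hx e5), hba, hq by exact hx.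
reflexivity.
Qed.

(** Because F_a = F_b, every term of G_w carries the positive factor sigma (1 + x)^(sigma - 2) /
    al^2, which is divided out. *)
Lemma MPF_G_unit (sigma chi : R) (hsigma : 0 < sigma) (w : R -> R -> R) (x : R) :
  MPF_of_degree (H_velocity sigma hsigma) chi w -> 0 < x < 1 ->
  let al := - Da w x 1 / Db w x 1 in
  Db w x 1 * (sigma - 1) * (1 + al) ^ 2 - (1 + x) * hess_form w al x 1
    + 2 * (1 + x) * ((Db w x 1 - Da w x 1) / (x - 1)) <= 0.
Proof.
intros hw hx al.
assert (hp : Da w x 1 < 0) by (apply (mpf_Da_neg _ _ _ hw); lra).
assert (hq : 0 < Db w x 1).
(* By symmetry w_b(x, 1) = w_a(1, x), whose sign is prescribed. *)
{ replace (Db w x 1) with (Da w 1 x).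
  - apply (mpf_Da_pos _ _ _ hw); lra.
  - apply Derive_ext_loc, (filter_imp (fun z => 0 < z)); [|apply locally_pos; lra].
    intros z hz; apply (mpf_sym _ _ _ hw); lra. }
assert (hal : 0 < al) by (unfold al; apply Rdiv_lt_0_compat; lra).
pose proof (mpf_G _ _ _ hw x 1 ltac:(lra) ltac:(lra) ltac:(lra)) as hG.
unfold G_term in hG; simpl nv_fun in hG.
fold al in hG; change (alpha w x 1) with al in hG.
rewrite H_power_hess_form, H_power_Da, H_power_Db in hG by lra.
assert (e : Rpower (x + 1) (sigma - 1) = Rpower (x + 1) (sigma - 1 - 1) * (x + 1)).
{ rewrite <- (Rpower_1 (x + 1)) at 3 by lra.
  rewrite <- Rpower_plus; f_equal; ring. }
rewrite e in hG.
set (P := Rpower (x + 1) (sigma - 1 - 1)) in *.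
assert (hP : 0 < P) by apply exp_pos.
assert (hs : 0 < 1 / al ^ 2 * (sigma * P)).
{ repeat apply Rmult_lt_0_compat; try lra.
  apply Rinv_0_lt_compat, pow_lt; lra. }
apply (Rmult_le_reg_l _ _ _ hs); rewrite Rmult_0_r.
refine (Rle_trans _ _ _ (Req_le _ _ _) hG).
set (h := hess_form w al x 1); field; lra.
Qed.

(** * Contradiction at r = 2/5 *)

Lemma no_MPF_of_large_sigma (sigma : R) (hsigma : 0 < sigma) (w : R -> R -> R) :
  598 / 100 <= sigma -> ~ MPF (H_velocity sigma hsigma) w.
Proof.
intros hs [chi [_ hw]].
assert (hchi : 0 < chi).
{ apply (mpf_deg_contracting _ _ _ hw), H_velocity_contracting. }
pose proof (mpf_C2 _ _ _ hw) as dw; pose proof (mpf_homog _ _ _ hw) as hom.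
set (N := fun x => chi * w x 1 - (1 + x) * Da w x 1).
set (y := fun x => chi * w x 1 / N x).
assert (hg : forall x, 0 < x < 1 -> 0 < chi * w x 1).
{ intros x hx; apply Rmult_lt_0_compat, (mpf_pos _ _ _ hw); lra. }
assert (hp : forall x, 0 < x < 1 -> 0 < (1 + x) * - Da w x 1).
{ intros x hx; pose proof (mpf_Da_neg _ _ _ hw x 1 ltac:(lra) ltac:(lra)).
  apply Rmult_lt_0_compat; lra. }
assert (hN : forall x, 0 < x < 1 -> chi * w x 1 < N x).
{ intros x hx; specialize (hp x hx); unfold N; lra. }
assert (h1 : 1 <= y (2 / 5)).
{ apply (y_reaches_one (sigma - 1) y
    (fun x => chi * (w x 1 * Da w x 1
        + (1 + x) * (w x 1 * Da (Da w) x 1 - Da w x 1 ^ 2)) / N x ^ 2)).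
  - lra.
  - intros r hr; specialize (hg r ltac:(lra)); specialize (hN r ltac:(lra)).
    apply Rdiv_lt_0_compat; lra.
  - intros r hr; specialize (hg r ltac:(lra)); specialize (hN r ltac:(lra)).
    destruct (C2_quadrant_derivatives w r 1 dw) as (e1 & _ & e2 & _); try lra.
    unfold y, N in *; auto_derive; [repeat split; auto; lra|].
    fold (Da w r 1) (Da (Da w) r 1); field; lra.
  - intros r hr.
    assert (hr1 : 0 < r < 1) by lra.
    pose proof (MPF_G_unit sigma chi hsigma w r hw hr1) as hG; cbv zeta in hG.
    destruct (hess_form_unit w chi (- Da w r 1 / Db w r 1) r hom dw) as [e1 e2];
      [lra|].
    rewrite e2, e1 in hG.
    apply G_to_y; auto.
    + apply (mpf_pos _ _ _ hw); lra.
    + apply (mpf_Da_neg _ _ _ hw); lra. }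
(* Since w_a < 0, [N] exceeds chi w, so y < 1 at 2/5, against [h1]. *)
specialize (hg (2 / 5) ltac:(lra)); specialize (hN (2 / 5) ltac:(lra)).
unfold y in h1; apply (Rmult_le_compat_r (N (2 / 5))) in h1; [|lra].
unfold Rdiv at 2 in h1; rewrite Rmult_assoc, Rinv_l in h1 by lra.
lra.
Qed.

Theorem theorem8p3 (sigma : R) (hsigma : 0 < sigma) :
  (7 <= sigma -> ~ exists w : R -> R -> R, MPF (H_velocity sigma hsigma) w) /\
  (598 / 100 <= sigma ->
     ~ exists w : R -> R -> R, MPF (H_velocity sigma hsigma) w).
Proof.
split; intros hs [w hw];
  apply (no_MPF_of_large_sigma sigma hsigma w); [lra | exact hw | lra | exact hw].
Qed.
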